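(* For every integer $r\geq2$ there exists $x\in\mathbb{A}^{\mathbb{Z}^2}$ with $\mathbb{A}=\{0,1,\ldots,r-1\}$ such that $H_B=\{0\}$ for all $\varnothing\neq B\subsetneq\mathbb{A}$, $x$ admits a transverse recurrence direction, and $$p_x^{*\mathrm{ab}}(k)=(r-1)k+1\quad\text{for all }k\geq1.$$ In particular, $x$ is non-doubly periodic by projection.
   Context: Abelian maximal pattern complexity: for a finite set $S\subset\mathbb{Z}^2$ and $t\in\mathbb{Z}^2$, the $S$-factor of $x$ at $t$ is $x[t+S]=(x(t+s))_{s\in S}\in\mathbb{A}^S$. Two elements of $\mathbb{A}^S$ are Abelian equivalent if each letter of $\mathbb{A}$ occurs the same number of times in both. Let $p_x^{\mathrm{ab}}(S)$ be the number of Abelian equivalence classes of $S$-factors of $x$ (over all $t\in\mathbb{Z}^2$), and $p_x^{*\mathrm{ab}}(k)=\sup\{p_x^{\mathrm{ab}}(S): S\subset\mathbb{Z}^2,\ \#S=k\}$. Periods: for a word $y$ on $\mathbb{Z}^2$, $\operatorname{Per}(y)=\{p\in\mathbb{Z}^2: y(t+p)=y(t)\ \forall t\in\mathbb{Z}^2\}$, a subgroup of $\mathbb{Z}^2$. $y$ is doubly periodic if $\operatorname{Per}(y)$ contains two linearly independent vectors. For $\varnothing\neq B\subsetneq\mathbb{A}$, let $\pi_B(x)=\mathbf{1}_B\circ x\in\{0,1\}^{\mathbb{Z}^2}$ and $H_B=\operatorname{Per}(\pi_B(x))$. $x$ is non-doubly periodic by projection if $\pi_B(x)$ is not doubly periodic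 for every $\varnothing\neq B\subsetneq\mathbb{A}$. Recurrence directions: $\mathbb{P}^1(\mathbb{R})$ is the set of lines through $0$ in $\mathbb{R}^2$; $\operatorname{dir}(q)=\mathbb{R}q$ for $q\neq0$; identifying $\mathbb{P}^1(\mathbb{R})$ with $\mathbb{R}/\pi\mathbb{Z}$ by angle, $d_\pi([\theta],[\phi])=\min_{m\in\mathbb{Z}}|\theta-\phi-m\pi|$. Let $\Sigma_N=[-N,N]^2\cap\mathbb{Z}^2$. $\theta\in\mathbb{P}^1(\mathbb{R})$ is a recurrence direction of $x$ if for all $\varepsilon>0$ and $N\geq1$ there is $q\in\mathbb{Z}^2\setminus\{0\}$ with $x(z+q)=x(z)$ for all $z\in\Sigma_N$ and $d_\pi(\operatorname{dir}(q),\theta)<\varepsilon$. $\mathcal{R}(x)$ is the set of all recurrence directions. If $H_B$ has rank one, $\phi_{H_B}$ is the common direction of its nonzero elements; for $x$ non-doubly periodic by projection, $D_{\mathrm{bad}}(x)=\{\phi_{H_B}:\varnothing\neq B\subsetneq\mathbb{A},\ H_B\neq\{0\}\}$. A recurrence direction is transverse if it lies in $\mathcal{R}(x)\setminus D_{\mathrm{bad}}(x)$. *)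

(* Defs.v *)
From HB Require Import structures.
From mathcomp Require Import all_boot all_order all_algebra finmap ring lra.
From mathcomp Require Import all_classical all_reals all_analysis.

Set Implicit Arguments.
Unset Strict Implicit.
Unset Printing Implicit Defensive.

Import Order.TTheory GRing.Theory Num.Theory.

Local Open Scope classical_set_scope.
Local Open Scope ring_scope.

Notation Z2 := (int * int)%type.

Definition factor (A : finType) (x : Z2 -> A) (S : {fset Z2}) (t : Z2) :
    {ffun S -> A} :=
  [ffun s : S => x (t + val s)].

Definition factors (A : finType) (x : Z2 -> A) (S : {fset Z2}) :
    {set {ffun S -> A}} :=
  [set u | `[< exists t : Z2, u = factor x S t >]]%SET.

Definition abelian_equiv (A : finType) (S : {fset Z2}) (u v : {ffun S -> A}) :
    bool :=
  [forall a : A, #|[set s | u s == a]%SET| == #|[set s | v s == a]%SET|].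

Lemma abelian_equiv_rel (A : finType) (S : {fset Z2}) :
  equivalence_rel (@abelian_equiv A S).
Proof.
move=> u v w; split=> [|/forallP uv]; first exact/forallP.
by apply/forallP/forallP => h a; [rewrite -(eqP (uv a))|rewrite (eqP (uv a))].
Qed.

Definition pab (A : finType) (x : Z2 -> A) (S : {fset Z2}) : nat :=
  #|equivalence_partition (@abelian_equiv A S) (factors x S)|.

Definition pab_max (R : realType) (A : finType) (x : Z2 -> A) (k : nat) :
    \bar R :=
  ereal_sup [set ((pab x S)%:R)%:E | S in [set S : {fset Z2} | #|` S| = k]].

Definition Per (T : Type) (y : Z2 -> T) : set Z2 :=
  [set p | forall t, y (t + p) = y t].

Definition lin_indep (p q : Z2) : Prop :=
  forall a b : int, p *~ a + q *~ b = 0 -> a = 0 /\ b = 0.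

Definition doubly_periodic (T : Type) (y : Z2 -> T) : Prop :=
  exists p q, [/\ Per y p, Per y q & lin_indep p q].

(* The word 1_B o x; the letters 1 and 0 are true and false. *)
Definition proj (A : finType) (B : {set A}) (x : Z2 -> A) : Z2 -> bool :=
  fun z => x z \in B.

Definition H_ (A : finType) (x : Z2 -> A) (B : {set A}) : set Z2 :=
  Per (proj B x).

Definition proper_nonempty (A : finType) (B : {set A}) : bool :=
  (B != finset.set0) && (B \proper [set: A]%SET).

Definition non_doubly_periodic_by_projection (A : finType) (x : Z2 -> A) :
    Prop :=
  forall B : {set A}, proper_nonempty B -> ~ doubly_periodic (proj B x).

Definition line (R : realType) (v : R * R) : set (R * R) :=
  [set (a * v.1, a * v.2) | a in [set: R]].

Definition P1 (R : realType) : set (set (R * R)) :=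
  [set line v | v in [set v | v != 0]].

Definition dir (R : realType) (q : Z2) : set (R * R) :=
  line (q.1%:~R, q.2%:~R).

(* For L in P1 this is one real representative of the class of L in R/piZ;
   dpi below does not depend on the representative. *)
Definition angle (R : realType) (L : set (R * R)) : R :=
  xget 0 [set theta | L = line (cos theta, sin theta)].

Definition dpi (R : realType) (theta phi : R) : R :=
  inf [set `|theta - phi - m%:~R * pi| | m in [set: int]].

Definition dP1 (R : realType) (L M : set (R * R)) : R :=
  dpi (angle L) (angle M).

Lemma angleP (R : realType) (L : set (R * R)) :
  P1 L -> L = line (cos (angle L), sin (angle L)).
Proof.
move=> [[a b] /= v0 <-]; rewrite /angle.
apply: (@xgetPex _ 0 [set theta | line (a, b) = line (cos theta, sin theta)]).
have n0 : 0 < a ^+ 2 + b ^+ 2.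
  rewrite lt_neqAle addr_ge0 ?sqr_ge0// andbT eq_sym.
  by rewrite paddr_eq0 ?sqr_ge0// !sqrf_eq0 -xpair_eqE.
set n := Num.sqrt (a ^+ 2 + b ^+ 2).
have n_gt0 : 0 < n by rewrite sqrtr_gt0.
have n_neq0 := lt0r_neq0 n_gt0.
have n2 : n ^+ 2 = a ^+ 2 + b ^+ 2 by rewrite sqr_sqrtr// ltW.
have c1 : -1 <= a / n <= 1.
  rewrite -ler_norml normrM normfV (gtr0_norm n_gt0) ler_pdivrMr// mul1r.
  by rewrite -sqrtr_sqr ler_wsqrtr// lerDl sqr_ge0.
have ac : cos (acos (a / n)) = a / n by rewrite acosK.
have as_ : sin (acos (a / n)) = `|b| / n.
  rewrite sin_acos//.
  have -> : 1 - (a / n) ^+ 2 = (b / n) ^+ 2.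
    by rewrite !expr_div_n n2; field; rewrite -n2 sqrf_eq0.
  by rewrite sqrtr_sqr normrM normfV (gtr0_norm n_gt0).
suff [t ct st] : exists2 t, cos t = a / n & sin t = b / n.
  exists t => /=; rewrite ct st; apply/seteqP; split=> _ [k _ <-] /=.
    by exists (k * n) => //=; congr pair; field.
  by exists (k / n) => //=; congr pair; field.
have [b0|b0] := leP 0 b.
  by exists (acos (a / n)) => //; rewrite as_ ger0_norm.
by exists (- acos (a / n)); rewrite ?cosN// sinN as_ ltr0_norm// mulNr opprK.
Qed.

(* The infimum in dpi is a minimum. *)
Lemma dpi_min (R : realType) (theta phi : R) :
  exists2 m : int, dpi theta phi = `|theta - phi - m%:~R * pi|
    & forall n : int, dpi theta phi <= `|theta - phi - n%:~R * pi|.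
Proof.
pose d (n : int) := `|theta - phi - n%:~R * pi|.
have lbd n : dpi theta phi <= d n.
  by apply: ge_inf; [exists 0 => _ [k _ <-]; exact: normr_ge0|exists n].
suff [m dm] : exists m, forall n, d m <= d n.
  exists m => //; apply/eqP; rewrite eq_le lbd/=; apply: lb_le_inf.
    by exists (d 0), 0.
  by move=> _ [k _ <-]; exact: dm.
pose f := Num.floor ((theta - phi) / pi).
have := floor_itv ((theta - phi) / pi); rewrite -/f => /andP[].
rewrite ler_pdivlMr ?pi_gt0// ltr_pdivrMr ?pi_gt0// => lef ltf.
have dn n : (d f <= d n) || (d (f + 1) <= d n).
  have [nf|fn] := leP n f.
    apply/orP; left.
    have nf' : n%:~R * pi <= f%:~R * pi :> R.
      by rewrite ler_wpM2r ?pi_ge0// ler_int.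
    by rewrite /d !ger0_norm; lra.
  apply/orP; right.
  have nf' : (f + 1)%:~R * pi <= n%:~R * pi :> R.
    by rewrite ler_wpM2r ?pi_ge0// ler_int lezD1.
  by rewrite /d !ler0_norm; lra.
have [le1|/ltW le2] := leP (d f) (d (f + 1)).
  by exists f => n; case/orP: (dn n) => //; exact: le_trans.
by exists (f + 1) => n; case/orP: (dn n) => //; exact: le_trans.
Qed.

(* dpi is well defined on R/piZ. *)
Lemma dpiDpi (R : realType) (theta phi : R) (a b : int) :
  dpi (theta + a%:~R * pi) (phi + b%:~R * pi) = dpi theta phi.
Proof.
congr inf; apply/seteqP; split=> _ [m _ <-] /=.
  by exists (m - a + b) => //; rewrite intrD intrB; congr `|_|; ring.
by exists (m + a - b) => //; rewrite intrB intrD; congr `|_|; ring.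
Qed.

Definition Sigma (N : nat) : set Z2 :=
  [set z | `|z.1| <= N%:Z /\ `|z.2| <= N%:Z].

Definition recurrence_directions (R : realType) (A : finType) (x : Z2 -> A) :
    set (set (R * R)) :=
  [set theta | P1 theta /\
    forall (eps : R) (N : nat), 0 < eps -> (1 <= N)%N ->
      exists q : Z2, [/\ q != 0,
        forall z, Sigma N z -> x (z + q) = x z &
        dP1 (dir q) theta < eps]].

(* Satisfied by some L only if H has rank one, in which case L is unique. *)
Definition common_direction (R : realType) (H : set Z2) (L : set (R * R)) :
    Prop :=
  (exists2 p, H p & p != 0) /\ (forall p, H p -> p != 0 -> dir p = L).

Definition D_bad (R : realType) (A : finType) (x : Z2 -> A) :
    set (set (R * R)) :=
  [set L | exists B : {set A},
    [/\ proper_nonempty B, H_ x B <> [set 0] & common_direction (H_ x B) L]].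

Definition transverse (R : realType) (A : finType) (x : Z2 -> A) :
    set (set (R * R)) :=
  recurrence_directions x `\` D_bad x.

(* Main.v *)
Require Import Defs.
From mathcomp Require Import all_boot all_order all_algebra finmap.
From mathcomp Require Import zify ring lra.
From mathcomp Require Import all_classical all_reals all_analysis.

(* The word is x(z) = min(r - 1, max(0, floor(L z))) with L(z) = z1 + z2 sqrt 2.
   Along any translation of S the factors increase letter by letter with L(t),
   so they are determined by the sum of their letters, which takes at most
   (r - 1)k + 1 values; all of these occur when S is an arithmetic progression
   with a step of tiny positive slope L.  Although x is monotone across the
   line ker L, vectors q with L(q) positive and small, which exist among the
   powers of sqrt 2 - 1, nearly preserve it: hence ker L is a recurrence
   direction.  A period p of a projection has L(p) = 0, so p = 0. *)

Set Implicit Arguments.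
Unset Strict Implicit.
Unset Printing Implicit Defensive.

Import Order.TTheory GRing.Theory Num.Theory.

Local Open Scope classical_set_scope.
Local Open Scope ring_scope.

(** * The linear form L and its small positive values on the lattice *)

Definition sqrt2 (R : realType) : R := Num.sqrt 2.

Lemma sqrt2_sqr (R : realType) : sqrt2 R * sqrt2 R = 2.
Proof. by rewrite -expr2 sqr_sqrtr. Qed.

Lemma sqrt2_bounds (R : realType) : 1 < sqrt2 R < 3 / 2.
Proof.
have := sqrt2_sqr R; have : 0 <= sqrt2 R by exact: sqrtr_ge0.
by move: (sqrt2 R) => s; nra.
Qed.

Definition slope (R : realType) (z : Z2) : R :=
  z.1%:~R + z.2%:~R * sqrt2 R.

Lemma slopeD (R : realType) (y z : Z2) :
  slope R (y + z) = slope R y + slope R z.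
Proof. by rewrite /slope /= !intrD; ring. Qed.

Lemma slopeN (R : realType) (z : Z2) : slope R (- z) = - slope R z.
Proof. by rewrite /slope /= !intrN; ring. Qed.

Lemma slopeMn (R : realType) (z : Z2) n : slope R (z *+ n) = slope R z *+ n.
Proof.
elim: n => [|n IHn]; first by rewrite !mulr0n /slope /= mul0r addr0.
by rewrite !mulrS slopeD IHn.
Qed.

Lemma slope_int (R : realType) (n : int) : slope R (n, 0) = n%:~R.
Proof. by rewrite /slope /= mul0r addr0. Qed.

Lemma slope_eq0 (R : realType) (z : Z2) : slope R z = 0 -> z = 0.
Proof.
case: z => a b; rewrite /slope /= => ab0.
have /intr_inj ab : (a ^+ 2)%:~R = (2 * b ^+ 2)%:~R :> R.
  have -> : (a ^+ 2)%:~R = a%:~R ^+ 2 :> R by rewrite rmorphXn.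
  rewrite (_ : a%:~R = - (b%:~R * sqrt2 R)); last by lra.
  by rewrite intrM rmorphXn /= sqrrN exprMn [sqrt2 R ^+ 2]sqrt2_sqr; ring.
have nab : (`|a| ^ 2 = 2 * `|b| ^ 2)%N by rewrite -!abszX ab abszM.
have b0 : b = 0.
  apply/eqP; rewrite -absz_eq0; apply/negP => /negP nb0.
  have bgt0 : (0 < `|b|)%N by rewrite lt0n.
  (* The 2-adic valuation is even on the left and odd on the right. *)
  have := congr1 (logn 2) nab.
  rewrite lognM ?expn_gt0 ?bgt0// !lognX => /(congr1 odd).
  by rewrite oddD !oddM.
move: ab0; rewrite b0 mul0r addr0 => /eqP; rewrite intr_eq0 => /eqP ->.
by [].
Qed.

Lemma exists_slope_expr (R : realType) n :
  exists q, slope R q = (sqrt2 R - 1) ^+ n.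
Proof.
elim: n => [|n [q qn]]; first by exists (1, 0); rewrite slope_int expr0.
(* Coordinates of the product of [slope R q] and sqrt 2 - 1 in Z[sqrt 2]. *)
exists (q.2 + q.2 - q.1, q.1 - q.2).
rewrite exprSr -qn /slope /= !intrB intrD.
have := sqrt2_sqr R; move: (sqrt2 R) => s s2; ring: s2.
Qed.

Lemma exists_small_slope (R : realType) (d : R) :
  0 < d -> exists q, 0 < slope R q < d.
Proof.
move=> d0; have [n nd] : exists n, d^-1 < 2 ^+ n.
  exists (Num.bound d^-1).
  have d1 : 0 <= d^-1 by rewrite invr_ge0 ltW.
  apply: (lt_trans (archi_boundP d1)).
  by rewrite -natrX ltr_nat ltn_expl.
have [q qn] := exists_slope_expr R n; exists q; rewrite qn.
have /andP[s1 s2] := sqrt2_bounds R.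
apply/andP; split; first by rewrite exprn_gt0// subr_gt0.
(* Since sqrt 2 < 3/2, the power is at most 2^-n, which is below d. *)
apply: (@le_lt_trans _ _ (2^-1 ^+ n)).
  by rewrite lerXn2r// ?nnegrE; lra.
by rewrite exprVn invf_plt ?posrE ?exprn_gt0.
Qed.

(** * Angular distance controlled by the sine *)

Lemma sin_subpi_norm (R : realType) (u : R) (m : int) :
  `|sin (u - m%:~R * pi)| = `|sin u|.
Proof.
wlog m0 : u m / 0 <= m.
  move=> H; have [|m0] := leP 0 m; first exact: H.
  rewrite -(H (u - m%:~R * pi) (- m)); last by rewrite oppr_ge0 ltW.
  by rewrite intrN mulNr opprK subrK.
case: m m0 => // n _; rewrite -[in RHS](subrK (n%:~R * pi) u).
rewrite -pmulrn mulr_natl (alternatingn (@sinDpi R)).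
by rewrite normrM normrX normrN1 expr1n mul1r.
Qed.

(** Subtracting the nearest multiple of pi leaves some v with |v| <= pi/2, a range on which the sine
    increases; so a small sine forces a small v. *)
Lemma dpi_lt_sin (R : realType) (theta phi eps : R) :
  0 < eps <= pi / 2 -> `|sin (theta - phi)| < sin eps -> dpi theta phi < eps.
Proof.
move=> /andP[e0 epi]; have [m dm mmin] := dpi_min theta phi.
have := mmin (m + 1); have := mmin (m - 1).
rewrite -(sin_subpi_norm _ m) {}dm intrB intrD !mulrDl mulN1r mul1r.
set v := theta - phi - _ => h1 h2; rewrite !ltNge; apply: contra => ev.
have pi0 := pi_gt0 R.
(* Otherwise v + pi or v - pi would be shorter than v, against the minimality of m. *)
have {h1 h2} vpi : `|v| <= pi / 2.
  have := h1; have := h2.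
  rewrite (_ : theta - phi - (_ + pi) = v - pi); last by rewrite /v; ring.
  rewrite (_ : theta - phi - (_ - pi) = v + pi); last by rewrite /v; ring.
  have [v0|v0] := leP 0 v.
    rewrite (ger0_norm v0); have [vp|vp] := leP 0 (v - pi).
      by rewrite (ger0_norm vp); lra.
    by rewrite (ltr0_norm vp); lra.
  rewrite (ltr0_norm v0); have [vp|vp] := leP 0 (v + pi).
    by rewrite (ger0_norm vp); lra.
  by rewrite (ltr0_norm vp); lra.
have : sin eps <= sin `|v|.
  by rewrite leNgt ltr_sin ?in_itv/= -?leNgt//; lra.
move=> /le_trans; apply; have [v0|v0] := ler0P v.
  by rewrite sinN -normrN ler_norm.
exact: ler_norm.
Qed.

(** * The word and its monotonicity in L *)

(** [Num.truncn] vanishes on negative reals, which supplies the lower cut-off at 0. *)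
Definition level (R : realType) (n : nat) (y : R) : nat :=
  minn n (Num.truncn y).

Lemma gt_level (R : realType) n (y : R) j :
  (j < level n y)%N = (j < n)%N && (j.+1%:R <= y).
Proof. by rewrite /level leq_min truncn_gt_nat. Qed.

Lemma level_le (R : realType) n (y : R) : (level n y <= n)%N.
Proof. exact: geq_minl. Qed.

Lemma le_level (R : realType) n (y y' : R) :
  y <= y' -> (level n y <= level n y')%N.
Proof.
move=> yy'; rewrite leq_min level_le /= (leq_trans (geq_minr _ _))//.
exact: le_truncn.
Qed.

(** The top level j = n extends upwards without bound, hence the guarded upper bound. *)
Lemma level_eq (R : realType) n j (y : R) :
  (j <= n)%N -> j%:R <= y -> (j < n)%N ==> (y < j.+1%:R) -> level n y = j.
Proof.
move=> jn jy yj; apply/eqP; rewrite eqn_leq; apply/andP; split.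
  rewrite leqNgt gt_level; apply/negP => /andP[jn' jy'].
  by move: yj; rewrite jn' /= ltNge jy'.
by case: j jn jy {yj} => // j jn jy; rewrite gt_level jn.
Qed.

Definition staircase (R : realType) (n : nat) (z : Z2) : 'I_n.+1 :=
  inord (level n (slope R z)).

Lemma staircaseE (R : realType) n z :
  staircase R n z = level n (slope R z) :> nat.
Proof. by rewrite inordK// ltnS level_le. Qed.

(** * Sums of letters and the upper bound on the complexity *)

Definition weight n (S : {fset Z2}) (u : {ffun S -> 'I_n.+1}) : nat :=
  (\sum_s u s)%N.

Lemma weight_le n (S : {fset Z2}) (u : {ffun S -> 'I_n.+1}) :
  (weight u <= n * #|` S|)%N.
Proof.
rewrite /weight cardfE mulnC -sum_nat_const; apply: leq_sum => s _.
by rewrite -ltnS.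
Qed.

(** Grouping positions by letter expresses the weight through the letter counts alone. *)
Lemma abelian_equiv_weight n (S : {fset Z2}) (u v : {ffun S -> 'I_n.+1}) :
  abelian_equiv u v -> weight u = weight v.
Proof.
have weightE (w : {ffun S -> 'I_n.+1}) :
    weight w = (\sum_(a < n.+1) a * #|[set s | w s == a]%SET|)%N.
  rewrite /weight (partition_big w xpredT)//=; apply: eq_bigr => a _.
  rewrite (eq_bigr (fun=> a : nat)); last by move=> s /eqP ->.
  rewrite sum_nat_const mulnC; congr (_ * _)%N.
  by apply: eq_card => s; rewrite inE.
by move=> /forallP uv; rewrite !weightE; apply: eq_bigr => a _;
  rewrite (eqP (uv a)).
Qed.

Lemma factorsP (A : finType) (x : Z2 -> A) (S : {fset Z2}) u :
  reflect (exists t, u = Defs.factor x S t) (u \in factors x S).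
Proof. by rewrite finset.in_set; exact: asboolP. Qed.

Lemma mem_factors (A : finType) (x : Z2 -> A) S t :
  Defs.factor x S t \in factors x S.
Proof. by apply/factorsP; exists t. Qed.

(* Any two factors over [S] are comparable letter by letter. *)
Lemma weight_staircase_inj (R : realType) n (S : {fset Z2}) :
  {in factors (staircase R n) S &, injective (@weight n S)}.
Proof.
move=> _ _ /factorsP[t ->] /factorsP[t' ->].
wlog tt' : t t' / slope R t <= slope R t'.
  move=> H; have [|/ltW] := leP (slope R t) (slope R t'); first exact: H.
  by move=> /H{}H /esym/H.
move=> /eqP.
(* Equality case of a sum of inequalities: equal totals force equality at every position. *)
have := @leqif_sum S xpredT
  (fun s => Defs.factor (staircase R n) S t s ==
            Defs.factor (staircase R n) S t' s)
  (fun s => Defs.factor (staircase R n) S t s : nat)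
  (fun s => Defs.factor (staircase R n) S t' s : nat).
rewrite /weight => -[].
  move=> s _; split => //; rewrite !ffunE !staircaseE; apply: le_level.
  by rewrite !slopeD lerD2r.
move=> _ -> /forallP uv; apply/ffunP => s; exact/eqP/uv.
Qed.

Lemma pab_staircase_le (R : realType) n (S : {fset Z2}) :
  (pab (staircase R n) S <= n * #|` S| + 1)%N.
Proof.
(* There are at most as many classes as factors, and the weight embeds the factors into {0, ..., n
   #S}. *)
apply: (leq_trans (leq_imset_card _ _)).
rewrite addn1.
pose w u : 'I_(n * #|` S|).+1 := inord (@weight n S u).
suff /card_in_imset <- : {in factors (staircase R n) S &, injective w}.
  by rewrite -[leqRHS]card_ord max_card.
move=> u v uS vS /(congr1 val) /=; rewrite !inordK ?ltnS ?weight_le//.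
exact: weight_staircase_inj uS vS.
Qed.

(** * Arithmetic progressions and the lower bound *)

(** Equivalent factors have equal weights, so factors of distinct weights lie in distinct
    classes. *)
Lemma pab_ge_weights n m (x : Z2 -> 'I_n.+1) (S : {fset Z2}) :
  (forall i, (i < m)%N -> exists t, weight (Defs.factor x S t) = i) ->
  (m <= pab x S)%N.
Proof.
move=> H; have /choice[t tw] : forall i : 'I_m,
    exists t, weight (Defs.factor x S t) = i.
  by move=> i; exact: H.
pose class i :=
  [set v in factors x S | abelian_equiv (Defs.factor x S (t i)) v]%SET.
rewrite -{1}[m]card_ord -(@card_imset _ _ class).
  apply/subset_leq_card/fintype.subsetP => _ /imsetP[i _ ->].
  by apply: imset_f; exact: mem_factors.
move=> i j; set u := Defs.factor x S (t j) => /setP/(_ u).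
rewrite finset.in_set [in RHS]finset.in_set mem_factors.
have [-> _] := abelian_equiv_rel u u u; rewrite /= => /abelian_equiv_weight.
by rewrite /u !tw => /val_inj.
Qed.

Definition progression (q : Z2) (k : nat) : {fset Z2} :=
  [fset q *+ nat_of_ord i | i in 'I_k]%fset.

Lemma progression_inj (R : realType) (q : Z2) k :
  0 < slope R q -> injective (fun i : 'I_k => q *+ i).
Proof.
move=> q0 i j /(congr1 (slope R)); rewrite !slopeMn => /eqP.
rewrite -subr_eq0 -[_ *+ i]mulr_natr -[_ *+ j]mulr_natr -mulrBr mulf_eq0.
rewrite gt_eqF//=.
by rewrite subr_eq0 eqr_nat => /eqP /val_inj.
Qed.

Lemma sum_geq c k : (\sum_(j < k) (c <= j) = k - c)%N.
Proof.
elim: k => [|k IHk]; first by rewrite big_ord0.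
rewrite big_ord_recr /= IHk; have [ck|kc] := leqP c k.
  by rewrite addn1 subSn.
by rewrite addn0; apply/eqP; rewrite (eqP kc) subn_eq0 ltnW.
Qed.

Lemma weight_progression n (x : Z2 -> 'I_n.+1) (R : realType) q k t :
  0 < slope R q ->
  weight (Defs.factor x (progression q k) t) =
  (\sum_(i < k) x (t + q *+ i)%R)%N.
Proof.
move=> q0; rewrite /weight.
rewrite (eq_bigr (fun s : progression q k => x (t + val s) : nat)); last first.
  by move=> s _; rewrite ffunE.
rewrite -(@big_seq_fsetE _ _ _ _ _ xpredT (fun z => x (t + z) : nat)).
rewrite big_imfset /=; last by move=> i j _ _; exact: progression_inj q0 _ _.
by rewrite big_enum.
Qed.

(** Write i = a k + b with b < k. As the whole progression has slope length below 1, it can be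
    placed so that its last b points have just passed the threshold a + 1: they carry a + 1 and the
    others carry a. *)
Lemma staircase_weights (R : realType) n k q i :
  (0 < k)%N -> 0 < slope R q < k%:R^-1 -> (i < n * k + 1)%N ->
  exists t, weight (Defs.factor (staircase R n) (progression q k) t) = i.
Proof.
move=> k0 /andP[q0 qk]; rewrite addn1 ltnS => ink.
have kq : slope R q *+ k < 1.
  by rewrite -mulr_natr -ltr_pdivlMr ?ltr0n// mul1r.
set a := (i %/ k)%N; set b := (i %% k)%N.
have bk : (b < k)%N by rewrite ltn_mod.
have an : (a <= n)%N by rewrite -(mulnK n k0) leq_div2r.
(* With this t the point of index k - b has slope exactly a + 1. *)
exists ((a.+1 : int, 0) - q *+ (k - b)).
rewrite (weight_progression _ _ _ q0).
rewrite (eq_bigr (fun j : 'I_k => a + (k - b <= j))%N).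
  rewrite big_split /= sum_nat_const card_ord.
  by rewrite sum_geq subKn ?(ltnW bk)// mulnC -divn_eq.
move=> j _; rewrite staircaseE !slopeD slopeN !slopeMn slope_int.
set d := slope R q in q0 qk kq *.
have jk : d *+ j <= d *+ k by rewrite ler_pMn2l// ltnW.
have j0 : 0 <= d *+ j by rewrite mulrn_wge0// ltW.
have kb : d *+ (k - b) <= d *+ k by rewrite ler_pMn2l// leq_subr.
have kb0 : 0 <= d *+ (k - b) by rewrite mulrn_wge0// ltW.
rewrite -pmulrn -natr1.
have [kbj|jkb] := leqP (k - b) j; apply: level_eq => /=.
(* The letter a + 1 exists: a = n would force b = 0, and then no index j < k reaches k - b. *)
- rewrite addn1 ltnNge; apply/negP => na.
  have b0 : b = 0%N by move: ink; rewrite (divn_eq i k) -/a -/b; nia.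
  by move: kbj; rewrite b0 subn0 leqNgt ltn_ord.
- have : d *+ (k - b) <= d *+ j by rewrite ler_pMn2l.
  by rewrite natrD; lra.
- by apply/implyP => _; rewrite -natr1 natrD; lra.
- by rewrite addn0.
- by rewrite natrD; lra.
- have : d *+ j < d *+ (k - b) by rewrite ltr_pMn2l.
  by move=> ?; apply/implyP => _; rewrite -natr1 natrD; lra.
Qed.

(** * Every letter occurs, and projections have no nonzero period *)

Lemma staircase_int (R : realType) n (a : 'I_n.+1) :
  staircase R n (a : int, 0) = a.
Proof.
apply/val_inj; rewrite /= staircaseE slope_int -pmulrn; apply: level_eq => //.
  by rewrite -ltnS.
by rewrite ltr_nat ltnS leqnn implybT.
Qed.

Lemma PerMn (T : Type) (y : Z2 -> T) p m : Per y p -> Per y (p *+ m).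
Proof.
move=> yp; elim: m => [|m IHm] t; first by rewrite mulr0n addr0.
by rewrite mulrSr addrA yp IHm.
Qed.

Lemma PerN (T : Type) (y : Z2 -> T) p : Per y p -> Per y (- p).
Proof. by move=> yp t; rewrite -(yp (t - p)) subrK. Qed.

(* Multiples of a period of negative slope lead from any point into the
   half-plane where the letter is [0]. *)
Lemma Per_staircase (R : realType) n (B : {set 'I_n.+1}) :
  proper_nonempty B -> H_ (staircase R n) B = [set 0].
Proof.
move=> /andP[/set0Pn[a aB] /properP[_ [b _ bB]]].
apply/seteqP; split=> [p Bp|_ ->]; last by move=> t; rewrite addr0.
apply: (@slope_eq0 R); apply/eqP; apply: contrapT => /negP p0.
wlog pneg : p Bp p0 / slope R p < 0.
  move=> H; have [|p1] := ltP (slope R p) 0; first exact: H.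
  apply: (H (- p)); first exact: PerN.
    by rewrite slopeN oppr_eq0.
  by rewrite slopeN oppr_lt0 lt_neqAle eq_sym p0.
(* If B contains all letters or none, it is not both nonempty and proper. *)
suff const c : (c \in B) = (ord0 \in B).
  by move: bB; rewrite const -(const a) aB.
(* Enough steps along p to bring the point (c, 0), of slope c, to negative slope. *)
have [m mp] : exists m, c%:R < - slope R p *+ m.
  have cp : 0 <= c%:R / - slope R p by rewrite divr_ge0// oppr_ge0 ltW.
  exists (Num.bound (c%:R / - slope R p)).
  by rewrite -[ltRHS]mulr_natl -ltr_pdivrMr ?oppr_gt0// archi_boundP.
have := PerMn m Bp (c : int, 0); rewrite /Defs.proj staircase_int => <-.
suff -> : staircase R n ((c : int, 0) + p *+ m) = ord0 by [].
apply/val_inj; rewrite /= staircaseE slopeD slopeMn slope_int.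
move: mp; rewrite mulNrn -pmulrn => mp.
apply/eqP; rewrite -leqn0 leqNgt gt_level; apply/negP => /andP[_]; lra.
Qed.

(** * Translations of small positive slope fix the word on a box *)

Lemma positive_lower_bound (R : realType) (s : seq R) :
  exists2 d, 0 < d & {in s, forall u, 0 < u -> d <= u}.
Proof.
elim: s => [|v s [d d0 ds]]; first by exists 1.
exists (if 0 < v then Num.min v d else d).
  by case: ifP => // v0; rewrite lt_min v0.
move=> u; rewrite inE => /predU1P[-> v0|us u0].
  by rewrite v0 ge_min lexx.
by case: ifP => _; rewrite ?ge_min ds// orbT.
Qed.

Definition box (N : nat) : seq Z2 :=
  [seq (i%:Z - N%:Z, j%:Z - N%:Z) | i <- iota 0 N.*2.+1, j <- iota 0 N.*2.+1].

Lemma mem_box N z : Sigma N z -> z \in box N.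
Proof.
case: z => a b [/= aN bN].
rewrite (_ : (a, b) = (`|(a + N)%R|%N%:Z - N%:Z, `|(b + N)%R|%N%:Z - N%:Z)).
  by apply: (allpairs_f (fun i j : nat => (i%:Z - N%:Z, j%:Z - N%:Z)));
    rewrite mem_iota; lia.
by congr pair; lia.
Qed.

(** Take d at most every positive gap from a slope in the box up to a threshold 1, ..., n: a smaller
    positive shift crosses no threshold. *)
Lemma staircase_recurrence (R : realType) n N :
  exists2 d : R, 0 < d & forall q z, 0 < slope R q < d -> Sigma N z ->
    staircase R n (z + q) = staircase R n z.
Proof.
have [d d0 dmin] := positive_lower_bound
  [seq j.+1%:R - slope R z | z <- box N, j <- iota 0 n].
exists d => // q z /andP[q0 qd] Nz; apply/val_inj.
rewrite /= !staircaseE slopeD; apply/eqP; rewrite eqn_leq; apply/andP; split; last first.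
  by apply: le_level; rewrite lerDl ltW.
rewrite leqNgt gt_level; set j := level n _; apply/negP => /andP[jn jq].
have zj : slope R z < j.+1%:R.
  by rewrite ltNge; apply/negP => jz; have := ltnn j; rewrite gt_level jn jz.
have := dmin (j.+1%:R - slope R z); rewrite subr_gt0 => /(_ _ zj) H.
suff /H : j.+1%:R - slope R z \in
    [seq j.+1%:R - slope R z | z <- box N, j <- iota 0 n].
  by lra.
apply: (allpairs_f (fun z j => j.+1%:R - slope R z)); first exact: mem_box.
by rewrite mem_iota.
Qed.

(** * The kernel of L as a transverse recurrence direction *)

(** The scalar c is, up to sign, the inverse of the Euclidean norm of v. *)
Lemma line_cos_sin (R : realType) (v : R * R) (t : R) :
  line v = line (cos t, sin t) ->
  exists c, [/\ cos t = c * v.1, sin t = c * v.2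
    & c ^+ 2 * (v.1 ^+ 2 + v.2 ^+ 2) = 1].
Proof.
move=> vt; have : line v (cos t, sin t) by rewrite vt; exists 1; rewrite ?mul1r.
move=> [c _ [cv sv]]; exists c; split => //.
by rewrite mulrDr -!exprMn cv sv cos2Dsin2.
Qed.

Definition kernel_line (R : realType) : set (R * R) := line (sqrt2 R, -1).
Arguments kernel_line : clear implicits.

Lemma P1_kernel_line (R : realType) : P1 (kernel_line R).
Proof.
by exists (sqrt2 R, -1) => //=; rewrite xpair_eqE oppr_eq0 oner_eq0 andbF.
Qed.

Lemma P1_dir (R : realType) q : q != 0 -> P1 (dir q : set (R * R)).
Proof.
move=> q0; exists (q.1%:~R, q.2%:~R) => //=; apply: contra q0.
by rewrite !xpair_eqE !intr_eq0.
Qed.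

(* The sine of the angle between the two lines is, up to sign, [slope R q]
   divided by the norms of [q] and [(sqrt 2, -1)], both at least [1]. *)
Lemma dP1_kernel_line (R : realType) q (eps : R) :
  q != 0 -> 0 < eps <= pi / 2 ->
  `|slope R q| < sin eps -> dP1 (dir q) (kernel_line R) < eps.
Proof.
move=> q0 epspi qeps; apply: dpi_lt_sin => //; apply: le_lt_trans qeps.
have [c [/= cE sE c1]] := line_cos_sin (angleP (P1_dir R q0)).
have [l [/= clE slE l1]] := line_cos_sin (angleP (P1_kernel_line R)).
rewrite sinB cE sE clE slE.
rewrite (_ : _ - _ = c * l * slope R q); last by rewrite /slope; ring.
rewrite normrM ler_piMl// -sqrtr_sqr -sqrtr1 ler_wsqrtr// exprMn.
have q1 : 1 <= q.1%:~R ^+ 2 + q.2%:~R ^+ 2 :> R.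
  rewrite -!rmorphXn -rmorphD /= ler1z.
  by move: q0; case: (q) => a b; rewrite xpair_eqE /= => /nandP[]; nia.
have s2 : 1 <= sqrt2 R ^+ 2 + (-1) ^+ 2.
  by rewrite sqrrN expr1n lerDr sqr_ge0.
have c2 := sqr_ge0 c; have l2 := sqr_ge0 l.
by rewrite mulr_ile1//; nra.
Qed.

Lemma transverse_staircase (R : realType) n :
  transverse (staircase R n) (kernel_line R).
Proof.
(* All [H_] are trivial, so [D_bad] is empty. *)
split; last by move=> [B [/(@Per_staircase R) -> /(_ erefl)]].
split; first exact: P1_kernel_line.
(* The sine comparison requires an angle of at most pi/2. *)
move=> eps N eps0 _; set e := Num.min eps (pi / 2).
have pi0 := pi_gt0 R.
have e0 : 0 < e by rewrite lt_min eps0 divr_gt0.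
have epi : e <= pi / 2 by rewrite ge_min lexx orbT.
have sine : 0 < sin e by apply: sin_gt0_pi; lra.
have [d d0 dper] := staircase_recurrence R n N.
have [q /andP[q0]] : exists q, 0 < slope R q < Num.min d (sin e).
  by apply: exists_small_slope; rewrite lt_min d0.
rewrite lt_min => /andP[qd qe]; exists q.
have qn0 : q != 0 by apply: contraTneq q0 => ->; rewrite slope_int ltxx.
split=> // [z Nz|]; first by apply: dper => //; rewrite q0.
apply: (@lt_le_trans _ _ e); last by rewrite ge_min lexx.
by apply: dP1_kernel_line; rewrite ?e0// gtr0_norm.
Qed.

(** * The exact complexity and the conclusion *)

Lemma pab_max_staircase (R : realType) n k : (0 < k)%N ->
  pab_max R (staircase R n) k = ((n * k + 1)%N%:R)%:E.
Proof.
move=> k0; apply/eqP; rewrite eq_le; apply/andP; split.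
  apply: ge_ereal_sup => _ [S /= Sk <-].
  by rewrite lee_fin ler_nat -Sk pab_staircase_le.
have [q qk] : exists q, 0 < slope R q < k%:R^-1.
  by apply: exists_small_slope; rewrite invr_gt0 ltr0n.
apply: (@le_trans _ _ ((pab (staircase R n) (progression q k))%:R)%:E).
  by rewrite lee_fin ler_nat; apply: pab_ge_weights => i;
    exact: staircase_weights.
apply: ereal_sup_ubound; exists (progression q k) => //=.
rewrite card_imfset /= ?size_enum_ord -?cardE ?card_ord//.
by case/andP: qk => q0 _; exact: (progression_inj q0).
Qed.

Theorem proposition1p8 (R : realType) (r : nat) (hr : (2 <= r)%N) :
  exists x : Z2 -> 'I_r,
    [/\ forall B : {set 'I_r}, proper_nonempty B -> H_ x B = [set 0],
        exists theta : set (R * R), transverse x theta,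
        forall k : nat, (1 <= k)%N ->
          pab_max R x k = (((r - 1) * k + 1)%N%:R)%:E &
        non_doubly_periodic_by_projection x].
Proof.
case: r hr => // n _; exists (staircase R n); split.
- by move=> B; exact: Per_staircase.
- by exists (kernel_line R); exact: transverse_staircase.
- by move=> k k0; rewrite subn1; exact: pab_max_staircase.
move=> B /(@Per_staircase R) HB [p [q [pB _ pq]]].
have p0 : p = 0 by have : H_ (staircase R n) B p by []; rewrite HB.
(* The only period p is 0, and the relation 1 p + 0 q = 0 refutes independence. *)
have pq0 : p *~ 1 + q *~ 0 = 0 by rewrite p0 mul0rz mulr0z addr0.
by have [] := pq 1 0 pq0.
Qed.
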